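(* Let $n \ge 1$ and $k \ge 1$ be integers, let $C \ge 4e$ be a real number such that $Cn$ is an integer, and let $x_1,\dots,x_n \in U$ be $n$ distinct keys from a universe $U$. Let $h : U \to [Cn]$ be a hash function drawn from a $2k$-wise independent family of hash functions. Then with probability at least $1-4 \cdot (4e/C)^{\min\{k,\,n/C\}}$ there are no more than $n/2$ indices $i \in [n]$ such that there exists $j \neq i$ with $h(x_i) = h(x_j)$.
   Context: $[m]$ denotes $\{1,\dots,m\}$. A family of hash functions $h:U\to[m]$ is $t$-wise independent if, for $h$ drawn from the family, for any $t$ distinct keys $y_1,\dots,y_t\in U$ the values $h(y_1),\dots,h(y_t)$ are independent and each uniformly distributed on $[m]$.
   Formalization: 2k-wise independence is required for every tuple of at most 2k distinct keys rather than exactly 2k; this is equivalent when |U| ≥ 2k, while for |U| < 2k the literal condition is vacuous and the claim fails (e.g. constant h, n = |U| = 100, k = 51, C = 29.56). *)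

(* Defs.v *)
From HB Require Import structures.
From mathcomp Require Export all_boot all_order all_algebra.
From mathcomp Require Export all_classical all_reals all_analysis.

Set Implicit Arguments.
Unset Strict Implicit.
Unset Printing Implicit Defensive.

Import Order.TTheory GRing.Theory Num.Theory.

Local Open Scope classical_set_scope.
Local Open Scope ring_scope.

(* A hash function drawn from a family is a random function on an arbitrary
   probability space (T, P): [h w : U -> 'I_m] is the function drawn at outcome
   [w].  The range {1, ..., m} is indexed from 0 as ['I_m]. *)
Section RandomHash.
Context d (T : measurableType d) (R : realType) (P : probability T R).
Context (U : Type) (m : nat).

(* ['I_m] carries no measurableType instance; it is finite and discrete, so
   measurability of singleton preimages is measurability of X. *)
Definition discrete_rv (X : T -> 'I_m) : Prop :=
  forall v : 'I_m, measurable [set w | X w = v].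

Definition random_hash (h : T -> U -> 'I_m) : Prop :=
  forall u : U, discrete_rv (fun w => h w u).

Definition mutually_independent (t : nat) (X : 'I_t -> T -> 'I_m) : Prop :=
  forall B : 'I_t -> set 'I_m,
    P [set w | forall i, B i (X i w)] = (\prod_(i < t) P [set w | B i (X i w)])%E.

Definition uniformly_distributed (X : T -> 'I_m) : Prop :=
  forall v : 'I_m, P [set w | X w = v] = (m%:R^-1 : R)%:E.

(* The tuples of distinct keys have length at most t, rather than exactly t.
   This is the same condition as soon as U has at least t elements (extend the
   tuple and marginalize); for smaller U there are no t distinct keys, and
   quantifying over exactly t keys would make the condition vacuous. *)
Definition wise_independent (t : nat) (h : T -> U -> 'I_m) : Prop :=
  forall (s : nat) (y : 'I_s -> U), (s <= t)%N -> injective y ->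
    mutually_independent (fun i w => h w (y i)) /\
    (forall i, uniformly_distributed (fun w => h w (y i))).

End RandomHash.

Definition colliding (U : Type) (m n : nat) (f : U -> 'I_m) (x : 'I_n -> U) :
    {set 'I_n} :=
  [set i : 'I_n | [exists j : 'I_n, (j != i) && (f (x i) == f (x j))]]%SET.

(* Main.v *)
(** Let l be the ceiling of min(k, n/C), so l <= k and l - 1 < n/C.
Let Z be the number of sequences of l disjoint ordered pairs of indices whose
keys collide within each pair.  By 2k-wise independence,
E[Z] <= n^(2l) / (Cn)^l = (n/C)^l.  If X > n/2 indices collide, such a sequence
can be built greedily: i chosen pairs spoil at most 3i colliding indices (their
own 2i entries, and in each of the at most i buckets they meet at most one index
left without a partner), so
Z >= \prod_(i < l) (X - 3i) >= (n/2 - 3n/(4e))^l >= (n/(4e))^l.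
Markov's inequality bounds the failure probability by (4e/C)^l. *)

Require Import Defs.
From mathcomp Require Import all_boot all_order all_algebra.
From mathcomp Require Import all_classical all_reals all_analysis.
From mathcomp Require Import zify ring lra.

Set Implicit Arguments.
Unset Strict Implicit.
Unset Printing Implicit Defensive.

Import Order.TTheory GRing.Theory Num.Theory.

Local Open Scope classical_set_scope.
Local Open Scope ring_scope.

(** * Counting collision matchings of a fixed function *)

Lemma colliding_ffun (U : Type) (m n : nat) (f : U -> 'I_m) (x : 'I_n -> U) :
  colliding f x = colliding [ffun i => f (x i)] id.
Proof.
by apply/setP => i; rewrite !inE; apply: eq_existsb => j; rewrite !ffunE.
Qed.

(** The pairs and their sequence are ordered, so that counting proceeds one factor per pair. Listing
    all first entries before all second ones fits the later split of ['I_(l + l)] by [lshift] and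
    [rshift]. *)
Definition collision_matching (I B : finType) (f : I -> B)
    (t : seq (I * I)) : bool :=
  uniq (unzip1 t ++ unzip2 t) && all (fun p => f p.1 == f p.2) t.

Lemma collision_matching_cons (I B : finType) (f : I -> B) (p : I * I) t :
  collision_matching f (p :: t) =
  [&& p.1 != p.2, p.1 \notin unzip1 t ++ unzip2 t,
      p.2 \notin unzip1 t ++ unzip2 t, f p.1 == f p.2 & collision_matching f t].
Proof.
have Ep : perm_eq (unzip1 (p :: t) ++ unzip2 (p :: t))
                  [:: p.1, p.2 & unzip1 t ++ unzip2 t].
  rewrite /= perm_cons -[p.2 :: unzip2 t]/([:: p.2] ++ _).
  by rewrite -[p.2 :: unzip1 t ++ _]/([:: p.2] ++ _ ++ _) perm_catCA perm_refl.
rewrite /collision_matching (perm_uniq Ep) /= inE negb_or.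
by case: (p.1 == p.2); case: (p.1 \in _); case: (p.2 \in _); case: (f _ == _);
   rewrite ?andbT ?andbF.
Qed.

(** A colliding index that cannot start a new pair is either one of the [2 * size t] entries of [t],
    or lies outside [t] with all its partners in [t] (the set [D]). The latter are at most [size t]
    many: their hash values are distinct and each is the common value of a pair of [t]. *)
Lemma card_free_collisions (U : Type) (m n : nat) (f : U -> 'I_m)
    (x : 'I_n -> U) (t : seq ('I_n * 'I_n)) :
  collision_matching (f \o x) t ->
  (#|colliding f x| - 3 * size t <=
   #|[set p | collision_matching (f \o x) (p :: t)]%SET|)%N.
Proof.
move=> tm; set s := unzip1 t ++ unzip2 t.
pose free i j := [&& j != i, i \notin s, j \notin s & f (x i) == f (x j)].
pose A := [set i in colliding f x | [exists j, free i j]]%SET.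
pose D := [set i in colliding f x |
  (i \notin s) && ~~ [exists j, free i j]]%SET.
have AD : (#|colliding f x| <= #|A| + size s + #|D|)%N.
  apply: (@leq_trans #|A :|: [set i in s]%SET :|: D|%SET).
    apply: subset_leq_card; apply/fintype.subsetP => i iX; rewrite !inE.
    rewrite inE in iX; rewrite iX /=.
    by case: (i \in s); rewrite ?orbT //= orbF; case: [exists j, _].
  apply: (leq_trans (leq_card_setU _ _)); rewrite leq_add2r.
  apply: (leq_trans (leq_card_setU _ _)); rewrite leq_add2l.
  by rewrite cardsE card_size.
have ss : size s = (2 * size t)%N by rewrite size_cat !size_map mul2n addnn.
have Dt : (#|D| <= size t)%N.
  (* Two distinct elements of [D] in one bucket would be free partners of each other. *)
  have fD : {in D &, injective (f \o x)}.
    move=> i j; rewrite !inE => /and3P[_ iNs iN] /and3P[_ jNs _] /= fij.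
    apply/eqP; apply: contraNT iN => ij; apply/existsP; exists j.
    by rewrite /free eq_sym ij iNs jNs fij eqxx.
  rewrite -(card_in_imset fD).
  apply: (@leq_trans (size [seq f (x p.1) | p <- t])); last by rewrite size_map.
  apply: leq_trans (card_size _); apply: subset_leq_card.
  apply/fintype.subsetP => _ /imsetP[i + ->].
  rewrite !inE => /and3P[/existsP[j /andP[ji fij]] iNs iN].
  have : j \in s.
    apply: contraNT iN => jNs; apply/existsP; exists j.
    by rewrite /free ji iNs jNs fij.
  move: tm => /andP[_ /allP tm].
  rewrite mem_cat => /orP[] /mapP[p pt jE]; apply/mapP; exists p => //=.
    by rewrite (eqP fij) jE.
  by rewrite (eqP fij) jE; exact/esym/eqP/(tm p pt).
pose S := [set p | collision_matching (f \o x) (p :: t)]%SET.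
(* Each index of [A] is the first entry of at least one admissible pair. *)
have Ac : (#|A| <= #|S|)%N.
  apply: (@leq_trans #|[set p.1 | p in S]%SET|); last exact: leq_imset_card.
  apply: subset_leq_card; apply/fintype.subsetP => i.
  rewrite !inE => /andP[_ /existsP[j /and4P[ji iNs jNs fij]]].
  apply/imsetP; exists (i, j) => //.
  by rewrite inE collision_matching_cons /= eq_sym ji iNs jNs fij tm.
rewrite -/S; lia.
Qed.

(** Induction on [l]: each matching of length [l] extends at its head in at least
    [#|colliding f x| - 3 * l] ways. Subtraction is truncated, so the bound becomes 0 once the
    greedy choice may get stuck. *)
Lemma card_collision_matchings (U : Type) (m n : nat) (f : U -> 'I_m)
    (x : 'I_n -> U) (l : nat) :
  (\prod_(i < l) (#|colliding f x| - 3 * i) <=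
   #|[set t : l.-tuple ('I_n * 'I_n) | collision_matching (f \o x) t]%SET|)%N.
Proof.
elim: l => [|l IH].
  rewrite big_ord0 card_gt0; apply/set0Pn; exists [tuple].
  by rewrite inE.
rewrite big_ord_recr /=.
pose pairs_t := (('I_n * 'I_n) * l.-tuple ('I_n * 'I_n))%type.
pose S := [set q : pairs_t | collision_matching (f \o x) (q.1 :: q.2)]%SET.
have <- : #|[set cons_tuple q.1 q.2 | q in S]%SET| =
    #|[set t : l.+1.-tuple ('I_n * 'I_n) | collision_matching (f \o x) t]%SET|.
  apply: eq_card => t; rewrite inE; apply/imsetP/idP => [[q + ->]|tm].
    by rewrite inE.
  case/tupleP: t tm => p t tm; exists (p, t); last exact/val_inj.
  by rewrite inE.
rewrite card_imset; last first.
  by move=> [p t] [p' t'] /= /(congr1 val) /= [-> /val_inj ->].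
rewrite -[#|S|]sum1_card.
rewrite (eq_bigl (fun q : pairs_t =>
  true && collision_matching (f \o x) (q.1 :: q.2))); last first.
  by move=> q; rewrite inE.
rewrite -(pair_big_dep xpredT (fun p (t : l.-tuple _) =>
  collision_matching (f \o x) (p :: t)) (fun _ _ => 1%N)) /=.
(* Fix the tail first, then count the heads that extend it. *)
rewrite (exchange_big_dep
  (fun t : l.-tuple _ => collision_matching (f \o x) t)) /=; last first.
  by move=> p t _; rewrite collision_matching_cons => /and5P[].
apply: leq_trans (leq_mul IH (leqnn _)) _.
rewrite -sum1_card big_distrl /=.
rewrite (eq_bigl (fun t : l.-tuple _ => collision_matching (f \o x) t)); last first.
  by move=> t; rewrite inE.
apply: leq_sum => t tm; rewrite mul1n.
have := card_free_collisions tm; rewrite size_tuple => /leq_trans; apply.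
by rewrite -sum1_card; under eq_bigl do rewrite inE.
Qed.


(** * Probability of collision matchings, and Markov's inequality *)

Section random_functions.
Context d (T : measurableType d) (R : realType) (P : probability T R).

Lemma measurable_finite_valued (A : finType) (X : T -> A) (E : pred A) :
  (forall a, measurable [set w | X w = a]) -> measurable [set w | E (X w)].
Proof.
move=> mX.
have -> : [set w | E (X w)] = \bigcup_(a in [set a | E a]) [set w | X w = a].
  by apply/seteqP; split=> [w /= EX|w [a /= Ea ->]//]; exists (X w).
by apply: fin_bigcup_measurable => //; exact: finite_finset.
Qed.

Lemma probability_finite_valued (A : finType) (X : T -> A) (E : pred A) :
  (forall a, measurable [set w | X w = a]) ->
  P [set w | E (X w)] = (\sum_(a | E a) fine (P [set w | X w = a]))%:E.
Proof.
move=> mX.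
have -> : [set w | E (X w)] = \bigcup_(a in [set a | E a]) [set w | X w = a].
  by apply/seteqP; split=> [w /= EX|w [a /= Ea ->]//]; exists (X w).
have tX : trivIset [set a | E a] (fun a => [set w | X w = a]).
  by move=> a b _ _ [w /= [Xa Xb]]; rewrite -Xa -Xb.
rewrite measure_fin_bigcup //; last exact: finite_finset.
rewrite EFin_sum_fine; last by move=> a _; rewrite fin_num_measure.
rewrite (@fsbigE _ _ _ _ _ (enum E)) ?enum_uniq //.
- rewrite big_enum_cond; apply: eq_bigl => a.
  by rewrite andb_idr // => Ea; exact: mem_set.
- by move=> a /=; rewrite mem_enum.
- by move=> a /= Ea; rewrite mem_enum -topredE /= Ea.
Qed.

Lemma measurable_ffun_random_hash (U : Type) (m s : nat) (h : T -> U -> 'I_m)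
    (y : 'I_s -> U) (g : {ffun 'I_s -> 'I_m}) :
  random_hash h -> measurable [set w | [ffun i => h w (y i)] = g].
Proof.
move=> mh.
have -> : [set w | [ffun i => h w (y i)] = g] =
    \bigcap_(i in [set: 'I_s]) [set w | h w (y i) = g i].
  apply/seteqP; split=> w /=; first by move=> <- i _; rewrite /= ffunE.
  by move=> wg; apply/ffunP => i; rewrite ffunE wg.
by apply: fin_bigcap_measurable => // i _; exact: mh.
Qed.

(** The [l + l] hash values are jointly uniform, so each value vector has probability
    [m ^- (l + l)]. A vector whose halves agree is determined by its left half, which leaves at most
    [m ^ l] vectors. *)
Lemma probability_pairs_collide (U : Type) (m t l : nat) (h : T -> U -> 'I_m)
    (y : 'I_(l + l) -> U) :
  random_hash h -> wise_independent P t h -> (l + l <= t)%N -> injective y ->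
  (P [set w | [forall j, h w (y (lshift l j)) == h w (y (rshift l j))]] <=
   (m%:R ^- l)%:E)%E.
Proof.
move=> mh ih lt yI; have [yind yunif] := ih _ y lt yI.
pose X w := [ffun i => h w (y i)].
pose E (g : {ffun 'I_(l + l) -> 'I_m}) :=
  [forall j, g (lshift l j) == g (rshift l j)].
have -> : [set w | [forall j, h w (y (lshift l j)) == h w (y (rshift l j))]] =
          [set w | E (X w)].
  by apply/seteqP; split=> w /= /forallP H; apply/forallP => j;
     have := H j; rewrite ?ffunE.
have PX g : fine (P [set w | X w = g]) = m%:R ^- (l + l) :> R.
  have -> : [set w | X w = g] = [set w | forall i, [set g i] (h w (y i))].
    apply/seteqP; split=> w /=; first by move=> <- i; rewrite ffunE.
    by move=> wg; apply/ffunP => i; rewrite ffunE wg.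
  rewrite (yind (fun i => [set g i])).
  rewrite (eq_bigr (fun=> ((m%:R : R)^-1)%:E)); last by move=> i _; exact: yunif.
  by rewrite prodEFin /= prodr_const card_ord exprVn.
rewrite (@probability_finite_valued _ X E); last first.
  by move=> g; exact: measurable_ffun_random_hash.
rewrite lee_fin (eq_bigr (fun=> m%:R ^- (l + l))) // sumr_const.
have cE : (#|E| <= m ^ l)%N.
  rewrite -[X in (_ <= X ^ _)%N]card_ord -[X in (_ <= _ ^ X)%N]card_ord -card_ffun.
  pose r (g : {ffun 'I_(l + l) -> 'I_m}) := [ffun j => g (lshift l j)].
  rewrite -(@card_in_imset _ _ r); first exact: max_card.
  move=> g g' /forallP gE /forallP gE' /ffunP rgg; apply/ffunP => i.
  case: (fintype.splitP i) => j ij.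
    have -> : i = lshift l j by exact/val_inj.
    by have := rgg j; rewrite !ffunE.
  have -> : i = rshift l j by exact/val_inj.
  by rewrite -(eqP (gE j)) -(eqP (gE' j)); have := rgg j; rewrite !ffunE.
rewrite -[leLHS]mulr_natr exprD invfM -mulrA ler_piMr ?invr_ge0 ?exprn_ge0 //.
apply: (@le_trans _ _ (m%:R ^- l * (m%:R ^+ l))).
  by rewrite ler_wpM2l ?invr_ge0 ?exprn_ge0 // -natrX ler_nat.
(* A zero power can arise only from [m = 0], where the product is 0 by convention. *)
have [->|ml0] := eqVneq (m%:R ^+ l : R) 0; first by rewrite mulr0 ler01.
by rewrite mulVf.
Qed.

Lemma probability_collision_matching (U : Type) (m n t l : nat)
    (h : T -> U -> 'I_m) (x : 'I_n -> U) (s : l.-tuple ('I_n * 'I_n)) :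
  random_hash h -> wise_independent P t h -> (l + l <= t)%N -> injective x ->
  (P [set w | collision_matching (h w \o x) s] <= (m%:R ^- l)%:E)%E.
Proof.
move=> mh ih lt xI.
pose c := cat_tuple (map_tuple fst s) (map_tuple snd s).
(* With a repeated index the event is empty; otherwise the entries are distinct keys and
   independence applies. *)
have [cU|cU] := boolP (uniq c); last first.
  rewrite [X in P X](_ : _ = set0) ?measure0 ?lee_fin ?invr_ge0 ?exprn_ge0 //.
  by apply/seteqP; split=> w //= /andP[]; rewrite (negbTE cU).
have yI : injective (x \o tnth c) by apply: inj_comp => //; exact/tuple_uniqP.
have := probability_pairs_collide mh ih lt yI.
rewrite [X in (P X <= _)%E -> _](_ : _ =
  [set w | collision_matching (h w \o x) s]) //.
apply/seteqP; split=> w /=.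
  move=> /forallP H; rewrite /collision_matching cU /=.
  apply/all_tnthP => j /=; have := H j.
  by rewrite !(tnth_lshift, tnth_rshift) !tnth_map.
move=> /andP[_ /all_tnthP H]; apply/forallP => j; have := H j.
by rewrite !(tnth_lshift, tnth_rshift) !tnth_map.
Qed.

(** Markov's inequality for the number of matchings of length [l], written as a finite sum over the
    values of the hash vector: on [E] there are at least [a ^+ l] matchings, while the expected
    number is at most [(n ^ 2 / m) ^ l]. *)
Lemma probability_many_collisions (U : Type) (m n t l : nat) (a : R)
    (h : T -> U -> 'I_m) (x : 'I_n -> U) (E : pred nat) :
  random_hash h -> wise_independent P t h -> (l + l <= t)%N -> injective x ->
  0 < a ->
  (forall c i, E c -> (i < l)%N -> a <= (c - 3 * i)%:R) ->
  (P [set w | E #|colliding (h w) x|] <=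
   ((n%:R ^+ 2 / (m%:R * a)) ^+ l)%:E)%E.
Proof.
move=> mh ih lt xI a0 Ea.
pose X w := [ffun i => h w (x i)].
have mX g : measurable [set w | X w = g] by exact: measurable_ffun_random_hash.
pose mu g := fine (P [set w | X w = g]).
have mu0 g : 0 <= mu g by rewrite fine_ge0.
pose EX (g : {ffun 'I_n -> 'I_m}) := E #|colliding g id|.
(* The event depends only on the hashes of the [n] keys, a random variable with values in a finite
   type. *)
rewrite [X in P X](_ : _ = [set w | EX (X w)]); last first.
  by apply/seteqP; split=> w /=; rewrite (colliding_ffun (h w)).
rewrite (probability_finite_valued EX mX) lee_fin.
pose M (g : {ffun 'I_n -> 'I_m}) :=
  [set s : l.-tuple ('I_n * 'I_n) | collision_matching (g \o id) s]%SET.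
have aM g : EX g -> a ^+ l <= #|M g|%:R.
  move=> Eg; have := card_collision_matchings g id l.
  rewrite -(ler_nat R); apply: le_trans.
  rewrite natr_prod -[X in _ ^+ X]card_ord -prodr_const.
  by apply: ler_prod => i _; rewrite (ltW a0) /= Ea.
rewrite invfM mulrA exprMn exprVn ler_pdivlMr ?exprn_gt0 // mulr_suml.
apply: (@le_trans _ _ (\sum_g mu g * #|M g|%:R)).
  rewrite [leRHS](bigID EX) /=.
  apply: ler_wpDr; first by apply: sumr_ge0 => g _; rewrite mulr_ge0.
  apply: ler_sum => g Eg; apply: ler_wpM2l; [exact: mu0|exact: aM].
(* Linearity of expectation: sum over the sequences [s] the probability that [s] is a matching. *)
have -> : \sum_g mu g * #|M g|%:R =
    \sum_(s : l.-tuple ('I_n * 'I_n))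
      \sum_(g : {ffun 'I_n -> 'I_m} | collision_matching (g \o id) s) mu g.
  rewrite (exchange_big_dep xpredT) //=; apply: eq_bigr => g _.
  rewrite sumr_const mulr_natr; congr (_ *+ _).
  by apply: eq_card => s; rewrite !inE.
apply: (@le_trans _ _ (\sum_(s : l.-tuple ('I_n * 'I_n)) m%:R ^- l)).
  apply: ler_sum => s _; rewrite -lee_fin.
  rewrite -(@probability_finite_valued _ X
    (fun g : {ffun 'I_n -> 'I_m} => collision_matching (g \o id) s) mX).
  apply: le_trans (probability_collision_matching s mh ih lt xI).
  rewrite le_eqVlt; apply/orP; left; apply/eqP; congr (P _).
  apply/seteqP; split=> w /=; rewrite /collision_matching => /andP[-> /allP H] /=;
    by apply/allP => p ps; have := H p ps; rewrite /= !ffunE.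
rewrite sumr_const card_tuple card_prod !card_ord -[leLHS]mulr_natl natrX natrM.
by rewrite -expr2 [leRHS]exprMn exprVn.
Qed.

End random_functions.

(** * Choice of the matching length and numerical estimates *)

Theorem theorem2 (R : realType) (d : measure_display) (T : measurableType d)
    (P : probability T R) (U : Type) (n k m : nat) (C : R)
    (x : 'I_n -> U) (h : T -> U -> 'I_m)
    (n_ge1 : (1 <= n)%N) (k_ge1 : (1 <= k)%N)
    (C_ge : 4 * expR 1 <= C) (Cn_int : C * n%:R = m%:R)
    (x_distinct : injective x)
    (h_random : random_hash h)
    (h_indep : wise_independent P (2 * k) h) :
  ((1 - 4 * (4 * expR 1 / C) `^ Num.min k%:R (n%:R / C))%:E <=
   P [set w : T | ((#|colliding (h w) x|%:R : R) <= n%:R / 2)%R])%E.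
Proof.
have e2 : 2 <= expR 1 :> R by have := expR_ge1Dx (1 : R); lra.
have n0 : 0 < n%:R :> R by rewrite ltr0n.
have C0 : 0 < C by lra.
set z := Num.min _ _; set q := 4 * expR 1 / C.
have z0 : 0 < z by rewrite lt_min ltr0n k_ge1 divr_gt0.
have q0 : 0 < q by rewrite divr_gt0 //; lra.
have q1 : q <= 1 by rewrite ler_pdivrMr // mul1r.
(* Rounding up gives [z <= l], needed for the exponent, while [l < z + 1] still yields [l <= k] and
   [i < n / C] for every [i < l]. *)
pose l := `|Num.ceil z|%N.
have lE : l%:R = (Num.ceil z)%:~R :> R.
  by rewrite -[LHS]/(l%:Z%:~R) /l gez0_abs // ceil_ge0 (lt_trans _ z0) // ltrN10.
have zl : z <= l%:R by rewrite lE ceil_ge.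
have lz : l%:R < z + 1.
  by rewrite lE -ltrBlDr -[1]/(1%:~R) -intrB -ceil_gt_int gtrBl.
have lk : (l <= k)%N.
  rewrite -ltnS -(ltr_nat R) -natr1; apply: lt_le_trans lz _.
  by rewrite lerD2r ge_min lexx.
pose E := [pred c | n%:R / 2 < c%:R :> R].
have mX g : measurable [set w | [ffun i => h w (x i)] = g].
  exact: measurable_ffun_random_hash.
have mE : measurable [set w | E #|colliding (h w) x|].
  have := measurable_finite_valued
    (fun g : {ffun 'I_n -> 'I_m} => E #|colliding g id|) mX.
  by congr measurable; apply/seteqP; split=> w /=; rewrite (colliding_ffun (h w)).
have -> : [set w | (#|colliding (h w) x|%:R : R) <= n%:R / 2] =
    ~` [set w | E #|colliding (h w) x|].
  by apply/seteqP; split=> w /=; rewrite leNgt => /negP.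
rewrite probability_setC // EFinB leeB //.
have a0 : 0 < n%:R / (4 * expR 1) :> R by rewrite divr_gt0 //; lra.
(* As [i < n / C <= n / (4e)], the difference exceeds [n / 2 - 3n / (4e)]. This is at least
   [n / (4e)] because [e >= 2] makes [4n / (4e) <= n / 2]. *)
have Ea c i : E c -> (i < l)%N -> n%:R / (4 * expR 1) <= (c - 3 * i)%:R :> R.
  rewrite /= => Ec il.
  have iz : i%:R < n%:R / C :> R.
    have : i.+1%:R <= l%:R :> R by rewrite ler_nat.
    have : z <= n%:R / C by rewrite ge_min lexx orbT.
    by rewrite -natr1; lra.
  have iCn : n%:R / C <= n%:R / (4 * expR 1).
    by rewrite ler_pM2l // lef_pV2 // posrE; lra.
  have n8 : n%:R / (4 * expR 1) <= n%:R / 8 :> R.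
    by rewrite ler_pM2l // lef_pV2 ?posrE //; lra.
  (* Truncated subtraction dominates real subtraction. *)
  apply: (@le_trans _ _ (c%:R - (3 * i)%:R)).
    by rewrite natrM; lra.
  by rewrite lerBlDr -natrD ler_nat addnC -leq_subLR.
apply: le_trans (probability_many_collisions h_random h_indep _ x_distinct a0 Ea) _.
  by rewrite mul2n -addnn leq_add.
(* Substituting [m = C * n] cancels both factors [n]. *)
have -> : n%:R ^+ 2 / (m%:R * (n%:R / (4 * expR 1))) = q.
  rewrite -Cn_int /q; field.
  by rewrite !gt_eqF // expR_gt0.
rewrite lee_fin -powR_mulrn ?(ltW q0) //.
(* Powers of [q <= 1] decrease in the exponent, and [z <= l]. *)
apply: (@le_trans _ _ (q `^ z)); first by apply: ger_powR; rewrite ?q0.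
by have := powR_ge0 q z; lra.
Qed.
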